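(* Let $n=rk$ with $k=3m$. Let $L$ be any $\mathbb{F}_{2^k}$-linear permutation on $\mathbb{F}_{2^n}$. Let $f:\mathbb{F}_{2^n}\to\mathbb{F}_{2^k}$ be such that $f$ has a $b$-linear translator $\gamma\in\mathbb{F}_{2^n}^*$ with $b\in\mathbb{F}_{2^m}^*$. Then the functions $$x\mapsto L(x)+L(\gamma)\left((f(x))^{2^{2m}+1}+(f(x))^{2^m+1}+\nu f(x)\right)$$ permute $\mathbb{F}_{2^n}$ for all $\nu\in\mathbb{F}_{2^m}\setminus\{0,1,b^{-1}\}$.
   Context: $\gamma$ is a $b$-linear translator of $f:\mathbb{F}_{2^n}\to\mathbb{F}_{2^k}$ if $f(x+u\gamma)-f(x)=ub$ for all $x\in\mathbb{F}_{2^n}$ and all $u\in\mathbb{F}_{2^k}$. *)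

(* Defs.v *)
From mathcomp Require Import all_boot all_algebra.

Set Implicit Arguments.
Unset Strict Implicit.
Unset Printing Implicit Defensive.

Import GRing.Theory.
Local Open Scope ring_scope.

(* In the intended use K = F_(2^k) and V = F_(2^n) is a field extension of K,
   with the inclusion of K acting through scaling. *)
Definition is_linear_translator (K : fieldType) (V : lmodType K)
    (f : V -> K) (gamma : V) (b : K) : Prop :=
  forall (x : V) (u : K), f (x + u *: gamma) - f x = u * b.

(* Main.v *)
Require Import Defs.
From mathcomp Require Import all_boot all_order all_algebra all_field.
From mathcomp Require Import ring.

Set Implicit Arguments.
Unset Strict Implicit.
Unset Printing Implicit Defensive.

Import GRing.Theory.
Local Open Scope ring_scope.

(* Applying L^-1 and then f turns x |-> L x + h (f x) *: L gamma into the map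
   g : t |-> t + h t * b on K, so it suffices that g is injective.
   Write q = 2 ^ m, let Tr t = t + t^q + t^(q^2) be the trace from K = F_(q^3)
   to F_q, and put a = 1 + nu b, which is nonzero.  In characteristic 2,
   g t = b (t^2 + t Tr t) + a t, hence Tr (g t) = a Tr t and g determines Tr t.
   If g s = g t with T = Tr s = Tr t, then d = s - t has trace 0 and satisfies
   d (b d + b T + a) = 0.  If d <> 0 then b d = b T + a lies in F_q, so it is
   equal to its own trace b Tr d = 0, which forces d = 0. *)

Lemma translator_bijective (K : finFieldType) (F : fieldExtType K)
    (L : {linear F -> F}) (f : F -> K) (gamma : F) (b : K) (h : K -> K) :
  injective L -> is_linear_translator f gamma b ->
  injective (fun t => t + h t * b) ->
  bijective (fun x => L x + h (f x) *: L gamma).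
Proof.
(* [finvect_type F] views [F] as a finite type, so injectivity is enough. *)
move=> injL hf injg; apply: (@injF_bij (finvect_type F)) => x y /=.
rewrite -!linearZ -!linearD => /injL eq_xy.
have f_shift z u : f (z + u *: gamma) = f z + u * b.
  by rewrite -(hf z u) addrCA subrr addr0.
have eq_f : f x = f y by apply: injg; rewrite -!f_shift eq_xy.
by move: eq_xy; rewrite eq_f => /addIr.
Qed.

(** Multiplication by a nonzero [x] permutes the nonzero elements of [E]; comparing their products
    before and after gives exponent [#|E| - 1] the value 1. *)
Lemma expf_card_divring (K : finFieldType) (E : {set K}) (x : K) :
  GRing.divring_closed E -> x \in E -> x ^+ #|E| = x.
Proof.
case=> E1 subE divE Ex; have E0 : 0 \in E by rewrite -(subrr 1) subE.
have [->|x_neq0] := eqVneq x 0.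
  by rewrite expr0n (cardD1 0) E0.
have mulE y : (x * y \in E) = (y \in E).
  have invE z : z \in E -> z^-1 \in E by move=> Ez; rewrite -div1r divE.
  apply/idP/idP => Ey; last by rewrite -[y]invrK divE ?invE.
  by rewrite -(mulKf x_neq0 y) mulrC divE.
have prod_neq0 : \prod_(y in E :\ 0) y != 0.
  by apply/prodf_neq0 => y; rewrite !inE => /andP[].
rewrite (cardsD1 0) E0 exprS -[RHS]mulr1; congr (_ * _).
apply: (mulIf prod_neq0); rewrite mul1r -prodr_const -big_split /=.
rewrite [RHS](reindex_onto ( *%R x) ( *%R x^-1)) /=; last first.
  by move=> y _; rewrite mulVKf.
apply: eq_bigl => y.
by rewrite !inE mulE mulf_eq0 (negPf x_neq0) mulKf // eqxx andbT.
Qed.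

(** Derives an equation from a known one by leaving their difference to [ring]. *)
Lemma eq_of_subr (V : zmodType) (x y u v : V) : u = v -> x - y = u - v -> x = y.
Proof. by move=> ->; rewrite subrr => /subr0_eq. Qed.

Lemma trace_perm_inj (K : finFieldType) (m : nat) (a b : K) :
  #|K| = (2 ^ (3 * m))%N -> a ^+ (2 ^ m) = a -> b ^+ (2 ^ m) = b ->
  a != 0 -> b != 0 ->
  injective (fun t : K =>
    b * (t ^+ (2 ^ (2 * m) + 1) + t ^+ (2 ^ m + 1)) + a * t).
Proof.
move=> cardK aq bq a_neq0 b_neq0 s t /=.
have charK : 2%N \in [pchar K] by apply: card_finPcharP cardK _.
have two0 : 2%:R = 0 :> K := pcharf0 charK.
pose phi (x : K) := x ^+ (2 ^ m).
have phiD x y : phi (x + y) = phi x + phi y.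
  by rewrite /phi exprDn_pchar // (eq_pnat _ (pcharf_eq charK)) pnatX pnat_id.
have phiM x y : phi (x * y) = phi x * phi y by rewrite /phi exprMn.
have phi2 x : x ^+ (2 ^ (2 * m)) = phi (phi x).
  by rewrite /phi -exprM -expnD mul2n addnn.
have phi3 x : phi (phi (phi x)) = x.
  by rewrite -[RHS]expf_card cardK mulSn -phi2 /phi -exprM -expnD.
have phia : phi a = a := aq.
have phib : phi b = b := bq.
rewrite !addn1 !exprSr !phi2 -!/(phi _) => eq0.
have eq1 := congr1 phi eq0; rewrite !(phiD, phiM, phi3, phia, phib) in eq1.
have eq2 := congr1 phi eq1; rewrite !(phiD, phiM, phi3, phia, phib) in eq2.
pose T := s + phi s + phi (phi s).
have eqT : T = t + phi t + phi (phi t).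
  apply: (mulfI a_neq0); apply: subr0_eq.
  (* In the sum of the three conjugate equations each cross term occurs twice; [ring] ignores the
     characteristic, so this multiple of 2 is made explicit. *)
  pose e x := x * phi x + x * phi (phi x) + phi x * phi (phi x).
  transitivity (- (2%:R * (b * (e s - e t)))); last by rewrite two0 mul0r oppr0.
  apply: (eq_of_subr (congr2 +%R (congr2 +%R eq0 eq1) eq2)).
  by rewrite /T /e; ring.
have phiT : phi T = T by rewrite /T !phiD phi3; ring.
have [d s_def] : exists d, s = t + d by exists (s - t); rewrite addrC subrK.
have trace_d : d + phi d + phi (phi d) = 0.
  by apply: (eq_of_subr eqT); rewrite /T s_def !phiD; ring.
have [d0|d_neq0] := eqVneq d 0; first by rewrite s_def d0 addr0.
have bd : b * d = b * T + a.
  apply: (mulfI d_neq0); apply: subr0_eq.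
  transitivity (- (2%:R * (b * t * d))); last by rewrite two0 mul0r oppr0.
  (* Eliminating the second conjugates also cancels the first ones, leaving a quadratic in [t] and
     [d] over [T], [a], [b]. *)
  have sE : phi (phi s) = T - s - phi s by rewrite /T; ring.
  have tE : phi (phi t) = T - t - phi t by rewrite eqT; ring.
  by apply: (eq_of_subr (esym eq0)); rewrite sE tE s_def; ring.
have bd1 := congr1 phi bd; rewrite !(phiD, phiM, phiT, phia, phib) in bd1.
have bd2 := congr1 phi bd1; rewrite !(phiD, phiM, phiT, phia, phib) in bd2.
clearbody T; have c0 : b * T + a = 0.
  (* All three conjugates of [b * d] equal c = [b * T + a], and c = 3c - 2c. *)
  transitivity (b * (d + phi d + phi (phi d)) - 2%:R * (b * T + a)).
    by rewrite !mulrDr bd bd1 bd2; ring.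
  by rewrite trace_d two0 mulr0 mul0r subr0.
by move/eqP: bd; rewrite c0 mulf_eq0 (negPf b_neq0) (negPf d_neq0).
Qed.

Theorem corollary5 (n r k m : nat) (hn : n = (r * k)%N) (hk : k = (3 * m)%N)
  (K : finFieldType) (cardK : #|K| = (2 ^ k)%N)
  (F : fieldExtType K) (cardF : #|finvect_type F| = (2 ^ n)%N)
  (E : {set K}) (subfieldE : GRing.divring_closed E) (cardE : #|E| = (2 ^ m)%N)
  (L : {linear F -> F}) (bijL : bijective L)
  (f : F -> K) (gamma : F) (gamma_neq0 : gamma != 0)
  (b : K) (bE : b \in E) (b_neq0 : b != 0)
  (hf : is_linear_translator f gamma b)
  (nu : K) (nuE : nu \in E) (hnu : nu \notin [:: 0; 1; b^-1]) :
  bijective (fun x : F =>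
    L x + (f x ^+ (2 ^ (2 * m) + 1) + f x ^+ (2 ^ m + 1) + nu * f x) *: L gamma).
Proof.
have fixE x : x \in E -> x ^+ (2 ^ m) = x.
  by rewrite -cardE; apply: expf_card_divring.
have charK : 2%N \in [pchar K] by apply: card_finPcharP cardK _.
pose h t := t ^+ (2 ^ (2 * m) + 1) + t ^+ (2 ^ m + 1) + nu * t.
apply: (translator_bijective (h := h) (bij_inj bijL) hf).
have a_neq0 : 1 + nu * b != 0.
  (* If the sum vanished, characteristic 2 would give [nu * b = 1], the excluded value [b^-1]. *)
  apply: contra hnu; rewrite addrC addr_eq0 oppr_pchar2 // => /eqP nub.
  by rewrite !inE -[nu](mulfK b_neq0) nub mul1r eqxx !orbT.
have aq : (1 + nu * b) ^+ (2 ^ m) = 1 + nu * b.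
  rewrite exprDn_pchar; last by rewrite (eq_pnat _ (pcharf_eq charK)) pnatX pnat_id.
  by rewrite expr1n exprMn !fixE.
rewrite hk in cardK.
apply: eq_inj (trace_perm_inj cardK aq (fixE b bE) a_neq0 b_neq0) _ => t.
by rewrite /h; ring.
Qed.
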